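(* Let $n\ge1$, let $X_1,\ldots,X_n,Z$ be random variables with any joint distribution taking values in the set of non-negative integers, let $\bar F_i(s)=P(X_i>s)$ for $i=1,\ldots,n$, $\bar G(s)=P(Z>s)$, and $T=X_{n:n}+Z$. Let $Y$ be a random variable with $P(Y>y)=\max_{i=1,\ldots,n}P(X_i>y)$ for all $y$, and assume $E\,Y<\infty$ and $E\,Z<\infty$. Let $t$ be a non-negative integer with $P(X_{n:n}>t)>0$ and fix $d>0$. If the non-negative integer $t_0$ satisfies $$\sum_{s=[(t_0+1)/2]}^{\infty}\bar G(s)\le\frac14\,d\,P(X_{n:n}>t)\qquad\text{and}\qquad\sum_{s=[(t_0+1)/2]}^{\infty}\max_{i=1,\ldots,n}\bar F_i(s)\le\frac{d\,P(X_{n:n}>t)}{4(2^n-1)},$$ where $[x]$ denotes the integer part of $x$, then the approximation $$E(T-t\mid X_{n:n}>t)\approx\frac1{P(X_{n:n}>t)}\sum_{s=t}^{t_0}\Big(\sum_{u=t+1}^{s}h_{1,n}(s,u)+P(X_{n:n}>s)\Big),\qquad h_{1,n}(s,u)=P(X_{n:n}=u,\ Z>s-u),$$ has error not greater than $d$ (in absolute value).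
   Context: $X_{n:n}=\max(X_1,\ldots,X_n)$. $T$ is the lifetime of a parallel ($1$-out-of-$n$) system with active component lifetimes $X_1,\ldots,X_n$ and one cold standby unit with lifetime $Z$. Empty sums are $0$. *)

(* Defs.v *)
From HB Require Import structures.
From mathcomp Require Import all_boot all_order all_algebra.
From mathcomp Require Import all_classical all_reals all_analysis.

Set Implicit Arguments.
Unset Strict Implicit.
Unset Printing Implicit Defensive.

Import Order.TTheory GRing.Theory Num.Theory.

Local Open Scope classical_set_scope.
Local Open Scope ring_scope.
Local Open Scope ereal_scope.

Definition maxlife (T : Type) (n : nat) (X : 'I_n -> T -> nat) (w : T) : nat :=
  (\max_(i < n) X i w)%N.

Definition syslife (T : Type) (n : nat) (X : 'I_n -> T -> nat) (Z : T -> nat)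
    (w : T) : nat :=
  (maxlife X w + Z w)%N.

Section probability.
Context (d : measure_display) (T : measurableType d) (R : realType).
Variable P : probability T R.

Definition survival (U : T -> nat) (s : nat) : \bar R :=
  P [set w | (s < U w)%N].

(* Only meaningful for n >= 1; the empty maximum is -oo. *)
Definition max_survival (n : nat) (X : 'I_n -> T -> nat) (s : nat) : \bar R :=
  \big[maxe/-oo]_(i < n) survival (X i) s.

(* Elementary conditional expectation given an event A with P A > 0. The
   integral is kept extended-real-valued, so no integrability is presupposed. *)
Definition cond_expectation (f : T -> R) (A : set T) : \bar R :=
  (fine (P A))^-1%:E * \int[P]_(w in A) (f w)%:E.

(* The natural-number subtraction is used only for u <= s. *)
Definition h1 (n : nat) (X : 'I_n -> T -> nat) (Z : T -> nat) (s u : nat) :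
    \bar R :=
  P [set w | maxlife X w = u /\ (s - u < Z w)%N].

Definition mean_residual_approx (n : nat) (X : 'I_n -> T -> nat) (Z : T -> nat)
    (t t0 : nat) : \bar R :=
  (fine (survival (maxlife X) t))^-1%:E *
  \sum_(t <= s < t0.+1)
    (\sum_(t.+1 <= u < s.+1) h1 X Z s u + survival (maxlife X) s).

End probability.

(* Main.v *)
(* Write M = X_{n:n}. On {M > t} the residual life M + Z - t counts the s >= t
   with M + Z > s, so its integral is the sum over s >= t of
   P(M > t, M + Z > s), and splitting on the value of M gives the bracket
   of the approximation. The error is thus a tail sum over s > t0. Since
   M + Z > s forces M > [s/2] or Z > [s/2], and each k occurs as [s/2] at most
   twice, the tail is at most
   2 (sum_{k >= [(t0+1)/2]} P(M > k) + sum_{k >= [(t0+1)/2]} P(Z > k)), and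
   P(M > k) <= n max_i P(X_i > k) with n <= 2^n - 1. *)
Require Import Defs.
From HB Require Import structures.
From mathcomp Require Import all_boot all_order all_algebra.
From mathcomp Require Import all_classical all_reals all_analysis.
From mathcomp Require Import measurable_realfun zify ring lra.

Set Implicit Arguments.
Unset Strict Implicit.
Unset Printing Implicit Defensive.

Import Order.TTheory GRing.Theory Num.Theory.

Local Open Scope classical_set_scope.
Local Open Scope ring_scope.
Local Open Scope ereal_scope.

(** Rounding the start [N] down to an even number only adds nonnegative terms, and the range then
    splits into pairs [2j], [2j+1] with the same half [j]. *)
Lemma half_nneseries_le (R : realType) (f : nat -> \bar R) (N : nat) :
  (forall k, 0 <= f k) ->
  \sum_(N <= s <oo) f (s %/ 2)%N <= 2%:E * \sum_(N %/ 2 <= k <oo) f k.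
Proof.
move=> f0; apply: lime_le.
  by apply: is_cvg_nneseries => k _ _; exact: f0.
apply: nearW => K.
have f20 k : 0 <= f (k %/ 2)%N by exact: f0.
have evenE m k : \sum_((m * 2)%N <= s < (k * 2)%N) f (s %/ 2)%N =
    2%:E * \sum_(m <= j < k) f j.
  elim: k => [|k IH]; first by rewrite mul0n !big_geq// mule0.
  have [mk|km] := leqP m k; last first.
    by rewrite !big_geq ?mule0// leq_mul2r km.
  have mk2 : (m * 2 <= k * 2)%N by rewrite leq_mul2r mk orbT.
  rewrite mulSn !addSn add0n big_nat_recr/= ?(leqW mk2)// big_nat_recr//=.
  rewrite IH [in RHS]big_nat_recr//= ge0_muleDr//; last by apply: sume_ge0.
  rewrite -addeA; congr (_ + _).
  have -> : ((k * 2).+1 %/ 2 = k)%N by rewrite divn2 muln2 /= uphalf_double.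
  rewrite mulnK//.
  by rewrite mule_natl mule2n.
(* The range from [N] to [K] is widened at both ends to even bounds, so that [evenE] applies; if
   [K < N], the partial sum is empty. *)
apply: (@le_trans _ _ (\sum_((N %/ 2 * 2)%N <= s < (K * 2)%N) f (s %/ 2)%N)).
  have NN : (N %/ 2 * 2 <= N)%N by exact: leq_trunc_div.
  have [NK|/ltnW KN] := leqP N K; last by rewrite big_geq//; apply: sume_ge0.
  have KK : (K <= K * 2)%N by rewrite muln2 -addnn leq_addr.
  rewrite [leRHS](big_cat_nat NN (leq_trans NK KK))/=.
  rewrite [X in _ + X](big_cat_nat NK KK)/=.
  by rewrite addeCA leeDl// adde_ge0//; apply: sume_ge0.
rewrite evenE lee_wpmul2l//.
by apply: nneseries_lim_ge.
Qed.

(** Exactly the first [b - a] terms equal 1. This is the pointwise identity behind the layer-cake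
    formula below. *)
Lemma natrB_nneseries (R : realType) (a b : nat) : (a <= b)%N ->
  (b%:R - a%:R)%:E = \sum_(k <oo) ((k + a < b)%N%:R : R)%:E.
Proof.
move=> ab; rewrite (nneseries_split 0 (b - a)%N)// add0n.
rewrite [X in _ + X]eseries0 ?adde0; last first.
  by move=> k + _; rewrite leq_subLR addnC leqNgt => /negbTE ->.
rewrite big_nat (eq_bigr (fun=> 1)) -?big_nat; last first.
  by move=> k /= kab; rewrite addnC -ltn_subRL kab.
by rewrite sumEFin sumr_const_nat subn0 natrB.
Qed.

Lemma natr_leq_pow2B1 (R : realType) (n : nat) : (n%:R <= 2 ^+ n - 1 :> R)%R.
Proof. by rewrite lerBrDr natr1 -natrX ler_nat ltn_expl. Qed.

Section lifetimes.
Context (d : measure_display) (T : measurableType d) (R : realType).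
Variable P : probability T R.

Lemma measurable_nat_preim (f : T -> nat) (p : pred nat) :
  measurable_fun [set: T] f -> measurable [set w | p (f w)].
Proof.
move=> mf; rewrite -[X in measurable X]setTI.
exact: (mf measurableT [set k | p k]).
Qed.

Lemma measurable_maxlife (n : nat) (X : 'I_n -> T -> nat) :
  (forall i, measurable_fun [set: T] (X i)) ->
  measurable_fun [set: T] (maxlife X).
Proof.
move=> mX; rewrite /maxlife.
elim: (index_enum _) => [|i r IH].
  by under eq_fun do rewrite big_nil; exact: measurable_cst.
by under eq_fun do rewrite big_cons; exact: measurable_fun_maxn.
Qed.

(** Union bound: the maximum exceeds [s] exactly when some [X i] does, and each of the [n]
    probabilities is at most the largest. *)
Lemma survival_maxlife_le (n : nat) (X : 'I_n -> T -> nat) (s : nat) :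
  (forall i, measurable_fun [set: T] (X i)) ->
  survival P (maxlife X) s <= n%:R%:E * max_survival P X s.
Proof.
move=> mX; rewrite /survival.
have -> : [set w | (s < maxlife X w)%N] =
    \big[setU/set0]_(i < n) [set w | (s < X i w)%N].
  apply/seteqP; split => w /=.
    rewrite -bigcup_seq => sM; apply: contrapT => nX.
    move: sM; apply/negP; rewrite -leqNgt; apply/bigmax_leqP => i _.
    rewrite leqNgt; apply/negP => sX; apply: nX; exists i => //=.
    by rewrite mem_index_enum.
  rewrite -bigcup_seq => -[i _ /=] sX.
  exact: leq_trans sX (leq_bigmax _).
apply: (@le_trans _ _ (\sum_(i < n) survival P (X i) s)).
  (* Measurability of the partial unions is carried through the induction, since binary
     subadditivity requires it at each step. *)
  suff [] : P (\big[setU/set0]_(i < n) [set w | (s < X i w)%N]) <=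
      \sum_(i < n) survival P (X i) s /\
      measurable (\big[setU/set0]_(i < n) [set w | (s < X i w)%N]) by [].
  elim/big_rec2 : _ => [|i A y _ [IH mA]]; first by rewrite measure0.
  have mXi := measurable_nat_preim (fun k => (s < k)%N) (mX i).
  split; last exact: measurableU.
  by apply: le_trans (measureU2 P mXi mA) _; exact: leeD.
apply: (@le_trans _ _ (\sum_(i < n) max_survival P X s)).
  apply: lee_sum => i _.
  exact: (le_bigmax _ (fun j => survival P (X j) s) i).
by rewrite sumr_const card_ord mule_natl.
Qed.

Lemma max_survival_ge0 (n : nat) (X : 'I_n -> T -> nat) (s : nat) :
  (1 <= n)%N -> 0 <= max_survival P X s.
Proof.
by move=> n1; apply: le_trans (le_bigmax _ _ (Ordinal n1)); exact: measure_ge0.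
Qed.

(** On [A] the integrand is a series of indicators of [S > k + t], and nonnegativity allows
    integrating term by term; both sides may be infinite. *)
Lemma integral_nat_layer_cake (S : T -> nat) (A : set T) (t : nat) :
  measurable A -> measurable_fun [set: T] S ->
  (forall w, A w -> (t <= S w)%N) ->
  \int[P]_(w in A) ((S w)%:R - t%:R)%:E =
  \sum_(t <= s <oo) P (A `&` [set w | (s < S w)%N]).
Proof.
move=> mA mS AS.
have mSs s : measurable [set w | (s < S w)%N].
  exact: measurable_nat_preim (fun k => (s < k)%N) mS.
rewrite -(nneseries_addn t)//.
transitivity (\int[P]_(w in A)
    \sum_(k <oo) (\1_[set v | (k + t < S v)%N] w : R)%:E).
  apply: eq_integral => w /set_mem Aw; rewrite natrB_nneseries ?AS//.
  by apply: eq_eseriesr => k _; rewrite indicE mem_setE.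
rewrite integral_nneseries//.
- by apply: eq_eseriesr => k _; rewrite integral_indic// setIC.
- by move=> k; apply/measurable_EFinP; exact: measurable_indic.
Qed.

(** The [h1] terms split the event [t < M <= s], [M + Z > s] by the value of [M = maxlife X]; when
    [M > s], the condition [M + Z > s] is automatic, which gives the survival term. *)
Lemma sum_h1E (n : nat) (X : 'I_n -> T -> nat) (Z : T -> nat) (t s : nat) :
  measurable_fun [set: T] (maxlife X) -> measurable_fun [set: T] Z ->
  (t <= s)%N ->
  \sum_(t.+1 <= u < s.+1) h1 P X Z s u + survival P (maxlife X) s =
  P ([set w | (t < maxlife X w)%N] `&` [set w | (s < syslife X Z w)%N]).
Proof.
move=> mM mZ ts.
have mU : measurable_fun [set: T] (syslife X Z) by exact: measurable_fun_addn.
have mE m : measurable ([set w | (t < maxlife X w <= m)%N] `&`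
    [set w | (s < syslife X Z w)%N]).
  apply: measurableI.
    exact: measurable_nat_preim (fun k => (t < k <= m)%N) mM.
  exact: measurable_nat_preim (fun k => (s < k)%N) mU.
have mh u : measurable [set w | maxlife X w = u /\ (s - u < Z w)%N].
  have mMu : measurable [set w | maxlife X w = u].
    rewrite [X in measurable X](_ : _ = [set w | maxlife X w == u]).
      exact: measurable_nat_preim (pred1 u) mM.
    by apply/seteqP; split => w /eqP.
  exact: measurableI mMu (measurable_nat_preim (fun k => (s - u < k)%N) mZ).
(* The cutoff [m] on the value of the maximum is separated from the threshold [s], which stays fixed
   during the induction; [m <= s] keeps the subtraction [s - u] exact. *)
have part m : (t <= m <= s)%N -> \sum_(t.+1 <= u < m.+1) h1 P X Z s u =
    P ([set w | (t < maxlife X w <= m)%N] `&` [set w | (s < syslife X Z w)%N]).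
  elim: m => [|m IH] /andP[tm ms].
    rewrite big_geq// [X in P X](_ : _ = set0) ?measure0//.
    by rewrite -subset0 => w /= [/andP[]]; lia.
  move: tm; rewrite leq_eqVlt => /predU1P[->|tm].
    rewrite big_geq// [X in P X](_ : _ = set0) ?measure0//.
    by rewrite -subset0 => w /= [/andP[]]; lia.
  rewrite big_nat_recr//= IH ?(ltnW ms) ?andbT// -measureU//.
    congr (P _); apply/seteqP; split => w /=; rewrite /syslife.
      by move=> [[/andP[? ?] ?]|[? ?]]; split; lia.
    move=> [/andP[? ?] ?]; have [?|?] := leqP (maxlife X w) m.
      by left; split; lia.
    by right; lia.
  by rewrite -subset0 => w /= [[/andP[_ +] _] []]; lia.
rewrite part ?ts ?leqnn// -measureU//.
- congr (P _); apply/seteqP; split => w /=; rewrite /syslife.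
    by move=> [[/andP[? ?] ?]|?]; split; lia.
  move=> [? ?]; have [?|?] := leqP (maxlife X w) s; last by right.
  by left; split; lia.
- exact: measurable_nat_preim (fun k => (s < k)%N) mM.
- by rewrite -subset0 => w /= [[/andP[_ +] _]]; lia.
Qed.

(** If both summands were at most [s %/ 2], their sum would be at most [s]. *)
Lemma measure_add_gt_le (M Z : T -> nat) (s : nat) :
  measurable_fun [set: T] M -> measurable_fun [set: T] Z ->
  P [set w | (s < M w + Z w)%N] <=
  survival P M (s %/ 2) + survival P Z (s %/ 2).
Proof.
move=> mM mZ.
have mM2 := measurable_nat_preim (fun k => (s %/ 2 < k)%N) mM.
have mZ2 := measurable_nat_preim (fun k => (s %/ 2 < k)%N) mZ.
apply: le_trans (measureU2 P mM2 mZ2); apply: le_measure; rewrite ?inE.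
- exact: measurable_nat_preim (fun k => (s < k)%N) (measurable_fun_addn mM mZ).
- exact: measurableU.
- by move=> w /=; lia.
Qed.

End lifetimes.
Theorem proposition3p5 (R : realType)
    (disp : measure_display) (T : measurableType disp) (P : probability T R)
    (n : nat) (n_ge1 : (1 <= n)%N)
    (X : 'I_n -> {RV P >-> nat}) (Z : {RV P >-> nat})
    (dispY : measure_display) (TY : measurableType dispY)
    (PY : probability TY R) (Y : {RV PY >-> R})
    (Y_tail : forall y : R,
      PY [set w | (y < Y w)%R] =
      \big[maxe/-oo]_(i < n) P [set w | (y < (X i w)%:R)%R])
    (EY_fin : 'E_PY[Y] < +oo)
    (EZ_fin : 'E_P[fun w => (Z w)%:R] < +oo)
    (t : nat) (Pt_gt0 : 0 < survival P (maxlife X) t)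
    (d : R) (d_gt0 : (0 < d)%R)
    (t0 : nat)
    (tail_Z : \sum_(t0.+1 %/ 2 <= s <oo) survival P Z s
      <= (4^-1 * d)%:E * survival P (maxlife X) t)
    (tail_X : \sum_(t0.+1 %/ 2 <= s <oo) max_survival P X s
      <= (d / (4 * (2 ^+ n - 1)))%:E * survival P (maxlife X) t) :
  `| cond_expectation P (fun w => (syslife X Z w)%:R - t%:R)%R
       [set w | (t < maxlife X w)%N]
     - mean_residual_approx P X Z t t0 | <= d%:E.
Proof.
set M := maxlife X.
have mX i : measurable_fun [set: T] (X i) by exact: measurable_funPT.
have mZ : measurable_fun [set: T] Z by exact: measurable_funPT.
have mM : measurable_fun [set: T] M by exact: measurable_maxlife.
have mS : measurable_fun [set: T] (syslife X Z) by exact: measurable_fun_addn.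
pose A := [set w | (t < M w)%N].
have mA : measurable A by exact: measurable_nat_preim (fun k => (t < k)%N) mM.
have mSs s : measurable [set w | (s < syslife X Z w)%N].
  exact: measurable_nat_preim (fun k => (s < k)%N) mS.
(* Up to the factor [1 / P(M > t)], the exact value sums [q s] over all [s >= t], and the
   approximation stops at [t0]. *)
pose q s := P (A `&` [set w | (s < syslife X Z w)%N]).
have q0 s : 0 <= q s by exact: measure_ge0.
have surv0 (U : T -> nat) s : 0 <= survival P U s by exact: measure_ge0.
have max0 s : 0 <= max_survival P X s by exact: max_survival_ge0.
pose p := fine (survival P M t).
have pE : survival P M t = p%:E by rewrite fineK// fin_num_measure.
have p_gt0 : (0 < p)%R by rewrite -lte_fin -pE.
have c_gt0 : (0 < 2 ^+ n - 1 :> R)%R.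
  by apply: lt_le_trans (natr_leq_pow2B1 R n); rewrite ltr0n.
(* The union bound costs a factor [n <= 2 ^+ n - 1], which the denominator in [tail_X] absorbs; a
   quarter of [d * p] remains, as for [Z]. *)
have tail_M : \sum_(t0.+1 %/ 2 <= s <oo) survival P M s <= (4^-1 * d * p)%:E.
  apply: (@le_trans _ _ (\sum_(t0.+1 %/ 2 <= s <oo)
      (2 ^+ n - 1)%:E * max_survival P X s)).
    apply: lee_nneseries => // s _.
    apply: le_trans (survival_maxlife_le P _ mX) _.
    by rewrite lee_wpmul2r// lee_fin natr_leq_pow2B1.
  rewrite nneseriesZl//.
  apply: le_trans (lee_wpmul2l _ tail_X) _; first by rewrite lee_fin ltW.
  rewrite pE -!EFinM lee_fin le_eqVlt; apply/predU1P; left; field.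
  by rewrite gt_eqF.
(* Two quarters of [d * p], doubled by the pairing of indices, give [p * d]. *)
have tail_q : \sum_(t0.+1 <= s <oo) q s <= (p * d)%:E.
  apply: (@le_trans _ _ (\sum_(t0.+1 <= s <oo)
      (survival P M (s %/ 2) + survival P Z (s %/ 2)))).
    apply: lee_nneseries => // s _.
    apply: le_trans (measure_add_gt_le P s mM mZ).
    by apply: le_measure; rewrite ?inE//; exact: measurableI.
  pose f k := survival P M k + survival P Z k.
  apply: le_trans (half_nneseries_le (f := f) _ _) _.
    by move=> k; exact: adde_ge0.
  rewrite nneseriesD//.
  apply: le_trans (lee_wpmul2l _ (leeD tail_M tail_Z)) _ => //.
  by rewrite pE -!EFinM lee_fin; lra.
have intE : \int[P]_(w in A) ((syslife X Z w)%:R - t%:R)%:E =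
    \sum_(t <= s <oo) q s.
  apply: integral_nat_layer_cake => // w /= /ltnW tM.
  exact: leq_trans tM (leq_addr _ _).
have sumE : \sum_(t <= s < t0.+1)
      (\sum_(t.+1 <= u < s.+1) h1 P X Z s u + survival P M s) =
    \sum_(t <= s < t0.+1) q s.
  by apply: eq_big_nat => s /andP[ts _]; rewrite sum_h1E.
(* If [t <= t0 + 1], the error [e] is the tail beyond [t0]. Otherwise the approximating sum is empty
   and [e] is the whole series from [t], part of that tail. *)
have [e [e0 ed eE]] : exists e, [/\ 0 <= e, e <= (p * d)%:E &
    \sum_(t <= s <oo) q s = \sum_(t <= s < t0.+1) q s + e].
  have [tt0|t0t] := leqP t t0.+1.
    exists (\sum_(t0.+1 <= s <oo) q s); split => //; first exact: nneseries_ge0.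
    by rewrite (@nneseries_split R q t (t0.+1 - t))// subnKC.
  exists (\sum_(t <= s <oo) q s); split; first exact: nneseries_ge0.
    apply: le_trans tail_q.
    rewrite [leRHS](@nneseries_split R q t0.+1 (t - t0.+1))//.
    rewrite subnKC ?(ltnW t0t)//.
    by rewrite leeDr// sume_ge0.
  by rewrite [X in X + _]big_geq ?add0e// ltnW.
(* With [e] and the finite sum both finite, the common part cancels in the reals, leaving the error
   [e / p], between 0 and [d]. *)
have eK : e \is a fin_num.
  by rewrite ge0_fin_numE//; exact: le_lt_trans ed (ltry _).
have bK : \sum_(t <= s < t0.+1) q s \is a fin_num.
  by apply/sum_fin_numP => s _ _; rewrite fin_num_measure//; exact: measurableI.
rewrite /cond_expectation /mean_residual_approx -/M -/A intE sumE eE {eE}.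
rewrite -[P A]/(survival P M t) -/p.
move: e0 ed; rewrite -(fineK eK) -(fineK bK).
move: (fine e) (fine (\sum_(t <= s < t0.+1) q s)) => r b.
rewrite !lee_fin => r0 rd.
rewrite -mulrBr addrAC subrr add0r.
rewrite ger0_norm; last by rewrite mulr_ge0 ?invr_ge0 ?(ltW p_gt0).
by rewrite ler_pdivrMl.
Qed.
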